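(* Let $S=\{(d_0,q_0),(d_1,q_1)\}$ be a regular alphabet--base system with $q_0,q_1\in(1,2]$, with associated sequences $\alpha^0,\gamma^1$ and set of unique expansions $\mathcal U_S'$. Then the following three properties are equivalent: (i) $\mathcal U_S'$ is an infinite set; (ii) $\alpha^0\succ(10)^\infty$ and $\gamma^1\prec(01)^\infty$; (iii) $q_0>1+\frac1{q_1}$ and $q_1>1+\frac1{q_0}$. Furthermore, if $\mathcal U_S'$ is not infinite, then $\mathcal U_S'=\{0^\infty,1^\infty\}$.
   Context: A (two-element) alphabet--base system is an indexed pair $S=\{(d_0,q_0),(d_1,q_1)\}$ of pairs of real numbers with $q_0,q_1>1$. A sequence is an element $(j_i)=j_1j_2\cdots$ of $\{0,1\}^{\mathbb N}$, $\mathbb N=\{1,2,\ldots\}$. Put $\pi((j_i))=\sum_{i=1}^{\infty}\frac{d_{j_i}}{q_{j_1}\cdots q_{j_i}}$ (always convergent). A sequence $(j_i)$ is an expansion of $x\in\mathbb R$ if $\pi((j_i))=x$. $w^\infty$ denotes the infinite repetition of a finite word $w$. We have $\pi(j^\infty)=\frac{d_j}{q_j-1}$; set $\lambda:=\min_j\pi(j^\infty)$, $\Lambda:=\max_j\pi(j^\infty)$. $S$ is regular if $\frac{d_0+\lambda}{q_0}<\frac{d_1+\lambda}{q_1}$, $\frac{d_0+\Lambda}{q_0}<\frac{d_1+\Lambda}{q_1}$ and $\frac{d_0+\Lambda}{q_0}\ge\frac{d_1+\lambda}{q_1}$. In this case $\lambda=\frac{d_0}{q_0-1}$ and $\Lambda=\frac{d_1}{q_1-1}$.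 $\prec,\preceq,\succ,\succeq$ denote the lexicographic order on sequences. A sequence is finite if it has a last element equal to $1$, and infinite otherwise (so $0^\infty$ is infinite); it is co-finite if it has a last element equal to $0$, and co-infinite otherwise (so $1^\infty$ is co-infinite). For regular $S$ and $x\in[\lambda,\Lambda]$, $a(x)$ denotes the lexicographically largest infinite expansion of $x$ and $m(x)$ the lexicographically smallest co-infinite expansion of $x$ (both exist). Define $\alpha^0:=a\left(q_0\left(\frac{d_1+\lambda}{q_1}-\frac{d_0}{q_0}\right)\right)$ and $\gamma^1:=m\left(q_1\left(\frac{d_0+\Lambda}{q_0}-\frac{d_1}{q_1}\right)\right)$; the arguments lie in $[\lambda,\Lambda]$ when $S$ is regular. $\mathcal U_S$ is the set of $x\in[\lambda,\Lambda]$ having exactly one expansion, and $\mathcal U_S'$ is the set of the corresponding expansions (sequences). *)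

(* Defs.v *)
From HB Require Import structures.
From mathcomp Require Import all_boot all_order all_algebra.
From mathcomp Require Import all_classical all_reals all_analysis.
Import Order.TTheory GRing.Theory Num.Theory numFieldNormedType.Exports.

Set Implicit Arguments.
Unset Strict Implicit.
Unset Printing Implicit Defensive.

Local Open Scope classical_set_scope.
Local Open Scope ring_scope.

(* A two-element alphabet-base system {(d_0, q_0), (d_1, q_1)}; the index 0 is
   [false] and the index 1 is [true]. *)
Record alphabet_base (R : realType) := AlphabetBase {
  digit : bool -> R;
  base : bool -> R;
  base_gt1 : forall b, 1 < base b }.

(* Sequences j_1 j_2 ... are indexed from 0: [j n] stands for j_(n+1).
   [big_lexi_order] carries the lexicographic order, in [order_scope]. *)
Notation sequence01 := (big_lexi_order (fun _ : nat => bool)).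

Definition wrep (w : seq bool) : sequence01 :=
  fun n => nth false w (n %% size w)%N.

(* "Infinite" means not ending in 1 0^oo, "co-infinite" not ending in 0 1^oo;
   in particular 0^oo is infinite and 1^oo is co-infinite. *)
Definition has_last (b : bool) (j : sequence01) : Prop :=
  exists n, j n = b /\ forall m, (n < m)%N -> j m != b.
Definition infinite_seq (j : sequence01) : Prop := ~ has_last true j.
Definition coinfinite_seq (j : sequence01) : Prop := ~ has_last false j.

Section AlphabetBaseTheory.
Variables (R : realType) (S : alphabet_base R).

Notation d0 := (digit S false).
Notation d1 := (digit S true).
Notation q0 := (base S false).
Notation q1 := (base S true).

Definition pival (j : sequence01) : R :=
  limn (series (fun i => digit S (j i) / \prod_(k < i.+1) base S (j k))).

Definition is_expansion (j : sequence01) (x : R) : Prop := pival j = x.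

Definition lambda_ : R :=
  Num.min (pival (wrep [:: false])) (pival (wrep [:: true])).
Definition Lambda_ : R :=
  Num.max (pival (wrep [:: false])) (pival (wrep [:: true])).

Definition regular : Prop :=
  [/\ (d0 + lambda_) / q0 < (d1 + lambda_) / q1,
      (d0 + Lambda_) / q0 < (d1 + Lambda_) / q1 &
      (d0 + Lambda_) / q0 >= (d1 + lambda_) / q1].

Definition is_max_infinite_expansion (x : R) (j : sequence01) : Prop :=
  [/\ is_expansion j x, infinite_seq j &
      forall j', is_expansion j' x -> infinite_seq j' -> (j' <= j)%O].
Definition is_min_coinfinite_expansion (x : R) (j : sequence01) : Prop :=
  [/\ is_expansion j x, coinfinite_seq j &
      forall j', is_expansion j' x -> coinfinite_seq j' -> (j <= j')%O].

(* When S is regular and lambda_ <= x <= Lambda_ these sequences exist (and are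
   unique), so that the default value of [xget] is irrelevant. *)
Definition a_exp (x : R) : sequence01 :=
  xget (wrep [:: false]) [set j | is_max_infinite_expansion x j].
Definition m_exp (x : R) : sequence01 :=
  xget (wrep [:: false]) [set j | is_min_coinfinite_expansion x j].

Definition alpha0 : sequence01 :=
  a_exp (q0 * ((d1 + lambda_) / q1 - d0 / q0)).
Definition gamma1 : sequence01 :=
  m_exp (q1 * ((d0 + Lambda_) / q0 - d1 / q1)).

Definition univoque : set R :=
  [set x | lambda_ <= x <= Lambda_ /\ exists! j, is_expansion j x].
Definition univoque_seq : set sequence01 :=
  [set j | exists2 x, univoque x & is_expansion j x].

End AlphabetBaseTheory.

(* Main.v *)
(* Conjugating affinely so that [lambda_ = 0] and [Lambda_ = 1], and putting
   [p b = 1 / q_b], the value [v] of a sequence satisfies [v (0 j) = p0 v(j)]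
   and [v (1 j) = 1 - p1 (1 - v(j))]; exchanging the digits replaces [v] by
   [1 - v].  A sequence is a unique expansion iff no tail takes its value in
   the switch region [[1 - p1, p0]].  The argument of alpha^0 is
   [s = (1 - p1) / p0], and [s > v((10)^oo)] iff [p0 (1 + p1) < 1], i.e. iff
   [q0 > 1 + 1/q1]; this transfers to the lexicographic order because two
   values separate, and do so at least as far, when a common prefix is removed.
   If [p0 (1 + p1) >= 1], the switch region forbids the blocks 011 and 100 in a
   unique expansion (the second because [p1 >= 1/2]), so a nonconstant one would
   end in [0 (10)^oo], whose value is in the switch region.  If both strict
   inequalities of (iii) hold, all [0^k (10)^oo] are unique expansions. *)
Require Import Defs.
From mathcomp Require Import all_boot all_order all_algebra.
From mathcomp Require Import all_classical all_reals all_analysis.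
From mathcomp Require Import ring lra.
Import Order.TTheory GRing.Theory Num.Theory numFieldNormedType.Exports.
Local Open Scope classical_set_scope.
Local Open Scope ring_scope.

(** * Sequences of binary digits *)

Lemma lexi_ltP (j j' : sequence01) :
  (j < j')%O <->
  exists n, [/\ forall m, (m < n)%N -> j m = j' m, j n = false & j' n = true].
Proof.
have le_first (i i' : sequence01) n : (forall m, (m < n)%N -> i m = i' m) ->
    i n != i' n -> (i <= i')%O = (i n <= i' n)%O.
  move=> pre ne; have /first_diff_SomeP fd : same_prefix n i i' /\ i n != i' n.
    by split.
  by rewrite leEbig_lexi_order fd.
split.
  rewrite lt_neqAle => /andP[ne].
  case fd: (first_diff j j') => [n|]; last first.
    by move/first_diff_NoneP: fd => fd; rewrite fd eqxx in ne.
  move/first_diff_SomeP: fd => [pre nen].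
  rewrite (@le_first _ _ n)// => le; exists n; split => //;
    by move: nen le; case: (j n); case: (j' n).
move=> [n [pre jn j'n]]; rewrite lt_neqAle; apply/andP; split.
  by apply/eqP => e; move: j'n; rewrite -e jn.
by rewrite (@le_first _ _ n)// jn j'n.
Qed.

Definition tail (n : nat) (j : sequence01) : sequence01 := fun k => j (n + k)%N.

Lemma tailD m n j : tail m (tail n j) = tail (n + m) j.
Proof. by apply: funext => k; rewrite /tail addnA. Qed.

Lemma tailS n j : tail 1 (tail n j) = tail n.+1 j.
Proof. by rewrite tailD addn1. Qed.

Definition flip (j : sequence01) : sequence01 := fun n => ~~ j n.

Lemma flipK : involutive flip.
Proof. by move=> j; apply: funext => n; rewrite /flip negbK. Qed.

Lemma lexi_lt_flip j j' : (flip j < flip j')%O <-> (j' < j)%O.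
Proof.
split=> /lexi_ltP[n [pre jn j'n]]; apply/lexi_ltP; exists n; split.
- by move=> m /pre /negb_inj.
- exact: negb_inj.
- exact: negb_inj.
- by move=> m /pre; rewrite /flip => ->.
- by rewrite /flip j'n.
- by rewrite /flip jn.
Qed.

Lemma lexi_le_flip j j' : (flip j <= flip j')%O = (j' <= j)%O.
Proof.
rewrite !leNgt; congr (~~ _).
by apply/idP/idP => /lexi_lt_flip.
Qed.

Lemma infinite_flip j : infinite_seq (flip j) <-> coinfinite_seq j.
Proof.
split=> h [n [jn jm]]; apply: h; exists n; split.
- by rewrite /flip jn.
- by move=> m /jm; rewrite /flip; case: (j m).
- by rewrite /flip in jn; case: (j n) jn.
- by move=> m /jm; rewrite /flip; case: (j m).
Qed.

(** The tail must contain a 1: if it were 0^oo, a digit 1 before position [n] could be the last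
    one. *)
Lemma infinite_tail n j : infinite_seq (tail n j) ->
  (exists k, tail n j k = true) -> infinite_seq j.
Proof.
move=> inf [k jk] [m [jm last]]; apply: inf.
have nkm : (n + k <= m)%N.
  by rewrite leqNgt; apply/negP => /last; rewrite -/(tail n j k) jk.
have nm : (n <= m)%N by rewrite (leq_trans (leq_addr k n)).
exists (m - n)%N; split; first by rewrite /tail subnKC.
by move=> i mi; apply: last; rewrite -(subnKC nm) ltn_add2l.
Qed.

Lemma wrep1 b n : wrep [:: b] n = b.
Proof. by rewrite /wrep /= modn1. Qed.

Lemma wrep10E n : wrep [:: true; false] n = ~~ odd n.
Proof. by rewrite /wrep /= modn2; case: odd. Qed.

Lemma wrep01E n : wrep [:: false; true] n = odd n.
Proof. by rewrite /wrep /= modn2; case: odd. Qed.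

Lemma flip_wrep10 : flip (wrep [:: true; false]) = wrep [:: false; true].
Proof. by apply: funext => n; rewrite /flip wrep10E wrep01E negbK. Qed.

Lemma tail_wrep10 n : ~~ odd n ->
  tail n (wrep [:: true; false]) = wrep [:: true; false].
Proof.
by move=> ne; apply: funext => k; rewrite /tail !wrep10E oddD (negbTE ne).
Qed.

Lemma tail1_wrep10 : tail 1 (wrep [:: true; false]) = wrep [:: false; true].
Proof. by apply: funext => k; rewrite /tail wrep10E wrep01E /= negbK. Qed.

Lemma tail1_wrep01 : tail 1 (wrep [:: false; true]) = wrep [:: true; false].
Proof. by apply: funext => k; rewrite /tail wrep10E wrep01E. Qed.

(** Rival expansions are built in this form: when [b] differs from [j n], the first difference with
    [j] is at [n]. *)
Definition graft (n : nat) (j : sequence01) (b : bool) (j' : sequence01) :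
  sequence01 :=
  fun k => if (k < n)%N then j k else if k == n then b else j' (k - n.+1)%N.

Lemma graft_lt n j b j' k : (k < n)%N -> graft n j b j' k = j k.
Proof. by rewrite /graft => ->. Qed.

Lemma graft_eq n j b j' : graft n j b j' n = b.
Proof. by rewrite /graft ltnn eqxx. Qed.

Lemma tail_graft n j b j' : tail n.+1 (graft n j b j') = j'.
Proof.
apply: funext => k; rewrite /tail /graft.
by rewrite ltnNge -ltnS ltnS leqW ?leq_addr//= gtn_eqF ?leq_addr// addKn.
Qed.

(** * Values satisfying the self-similarity relation *)

Definition branch (R : realType) (p : bool -> R) (b : bool) (x : R) : R :=
  if b then 1 - p true * (1 - x) else p false * x.
Arguments branch {R}.

(** The value enters the next section through this relation only, so each result there applies both
    to the normalized [pival] and to its image under exchange of the digits. *)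
Definition valuation (R : realType) (p : bool -> R) (v : sequence01 -> R) :=
  forall j, 0 <= v j <= 1 /\ v j = branch p (j 0%N) (v (tail 1 j)).

Definition max_infinite (R : realType) (v : sequence01 -> R) (x : R)
    (j : sequence01) : Prop :=
  [/\ v j = x, infinite_seq j &
      forall j', v j' = x -> infinite_seq j' -> (j' <= j)%O].

(* No tail of [j] has its value in the switch region [[1 - p true, p false]]. *)
Definition admissible (R : realType) (p : bool -> R) (v : sequence01 -> R)
    (j : sequence01) : Prop :=
  forall n, if j n then p false < v (tail n j)
            else v (tail n j) < 1 - p true.

Arguments valuation {R}.
Arguments max_infinite {R}.
Arguments admissible {R}.

Lemma valuation_flip (R : realType) (p : bool -> R) v : valuation p v ->
  valuation (fun b => p (~~ b)) (fun j => 1 - v (flip j)).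
Proof.
move=> hv j; have [hb he] := hv (flip j); split; first by lra.
rewrite he /branch /= {1}/flip.
have -> : flip (tail 1 j) = tail 1 (flip j) by [].
by case: (j 0%N) => /=; ring.
Qed.

Lemma admissible_flip (R : realType) (p : bool -> R) v j :
  admissible p v j ->
  admissible (fun b => p (~~ b)) (fun j => 1 - v (flip j)) (flip j).
Proof.
move=> h n; have := h n; rewrite /flip /=.
have -> : (fun n0 => ~~ tail n (fun k => ~~ j k) n0) = tail n j.
  by apply: funext => k; rewrite /tail negbK.
by case: (j n) => /= ?; lra.
Qed.

Section Valuation.
Variables (R : realType) (p : bool -> R) (v : sequence01 -> R).
Hypothesis p_half : forall b, 2^-1 <= p b.
Hypothesis p_lt1 : forall b, p b < 1.
Hypothesis hv : valuation p v.

Let v_ge0 j : 0 <= v j. Proof. by have [/andP[]] := hv j. Qed.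
Let v_le1 j : v j <= 1. Proof. by have [/andP[]] := hv j. Qed.

Lemma v_tail n j : v (tail n j) = branch p (j n) (v (tail n.+1 j)).
Proof. by have [_ ->] := hv (tail n j); rewrite tailS /tail addn0. Qed.

Lemma v_tail1 n j : j n = true ->
  v (tail n j) = 1 - p true * (1 - v (tail n.+1 j)).
Proof. by move=> jn; rewrite v_tail jn. Qed.

Lemma v_tail0 n j : j n = false -> v (tail n j) = p false * v (tail n.+1 j).
Proof. by move=> jn; rewrite v_tail jn. Qed.

(** The branches contract by a factor at most [c < 1], so two orbits in [0,1] along the same digits
    differ at each time by at most [c ^+ k], for every [k]. *)
Lemma v_orbit (x : nat -> R) j :
  (forall n, 0 <= x n <= 1 /\ x n = branch p (j n) (x n.+1)) ->
  forall n, v (tail n j) = x n.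
Proof.
move=> hx.
pose c := Num.max (p false) (p true).
have c0 : 0 <= c by rewrite le_max; have := p_half false; lra.
have pc b : p b <= c by rewrite le_max; case: b; rewrite lexx ?orbT.
have c1 : c < 1 by rewrite gt_max !p_lt1.
have bound k n : `|v (tail n j) - x n| <= c ^+ k.
  elim: k n => [|k IH] n.
    have [/andP[? ?] _] := hx n.
    rewrite expr0 ler_norml; have := v_ge0 (tail n j).
    by have := v_le1 (tail n j); lra.
  have [_ ->] := hx n; rewrite v_tail.
  have -> : branch p (j n) (v (tail n.+1 j)) - branch p (j n) (x n.+1)
      = p (j n) * (v (tail n.+1 j) - x n.+1).
    by rewrite /branch; case: (j n); ring.
  rewrite normrM exprS ler_pM// ger0_norm//.
  by have := p_half (j n); lra.
move=> n; apply/eqP; rewrite -subr_eq0 -normr_le0.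
have cvgc : (GRing.exp c : R ^nat) @ \oo --> 0.
  by apply: cvg_expr; rewrite ger0_norm.
rewrite -(cvg_lim (@Rhausdorff R) cvgc); apply: limr_ge; first exact: cvgP cvgc.
by apply: nearW => k; exact: bound.
Qed.

Lemma v_cst0 j : (forall n, j n = false) -> v j = 0.
Proof.
move=> j0; apply: (v_orbit (fun=> 0) j _ 0%N) => n.
by rewrite j0 /branch; split; lra.
Qed.

Lemma v_cst1 j : (forall n, j n = true) -> v j = 1.
Proof.
move=> j1; apply: (v_orbit (fun=> 1) j _ 0%N) => n.
by rewrite j1 /branch; split; lra.
Qed.

(** As 1 - p1 > 0, value 0 excludes a first digit 1, and a first digit 0 leaves a tail of value
    0. *)
Lemma v_eq0 j : v j = 0 -> forall n, j n = false.
Proof.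
move=> vj n; elim: n j vj => [|n IH] j vj.
  apply/negbTE/negP => j0; have := @v_tail1 0 j j0; rewrite [v (tail 0 j)]vj.
  by have := v_ge0 (tail 1 j); have := p_half true; have := p_lt1 true; nra.
have [j0|j0] := boolP (j 0%N).
  have := @v_tail1 0 j j0; rewrite [v (tail 0 j)]vj.
  by have := v_ge0 (tail 1 j); have := p_half true; have := p_lt1 true; nra.
apply: (IH (tail 1 j)).
have := @v_tail0 0 j (negbTE j0); rewrite [v (tail 0 j)]vj => /esym/eqP.
rewrite mulf_eq0 => /orP[/eqP e|/eqP//].
by have := p_half false; rewrite e; lra.
Qed.

(* The common prefix acts on the tail values through an affine map whose slope
   is a product of the [p b], the inverse of [K]. *)
Lemma v_prefix n j j' : (forall m, (m < n)%N -> j m = j' m) ->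
  exists2 K, 1 <= K & v (tail n j) - v (tail n j') = K * (v j - v j').
Proof.
elim: n => [|n IH] pre; first by exists 1 => //; rewrite mul1r.
have [m mn|K K1 e] := IH; first by apply: pre; exact: ltnW.
have P := p_half (j n); have P1 := p_lt1 (j n).
have p0 : p (j n) != 0 by rewrite gt_eqF//; lra.
exists (K / p (j n)).
  by rewrite ler_pdivlMr ?mul1r; [apply: (le_trans (ltW P1))|lra].
rewrite mulrAC -e (v_tail n j) (v_tail n j') -pre// /branch.
by case: (j n) p0 => p0; field.
Qed.

(** The two tails at [n] have equal values, and the nonzero factor [K] of [v_prefix] carries this
    back to position 0. *)
Lemma v_graft n j b j' : v (tail n j) = branch p b (v j') ->
  v (graft n j b j') = v j.
Proof.
move=> e; set g := graft n j b j'.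
have [K K1 eK] : exists2 K, 1 <= K &
    v (tail n g) - v (tail n j) = K * (v g - v j).
  by apply: v_prefix => m; exact: graft_lt.
have : v (tail n g) - v (tail n j) = 0.
  by rewrite e v_tail /g graft_eq tail_graft subrr.
rewrite eK => /eqP; rewrite mulf_eq0 subr_eq0 => /orP[/eqP e0|/eqP//].
by move: K1; rewrite e0; lra.
Qed.

(** * Quasi-greedy expansions and uniqueness *)

Fixpoint greedy_orbit (x : R) (n : nat) : R :=
  if n is n'.+1 then
    let y := greedy_orbit x n' in
    if 1 - p true < y then 1 - (1 - y) / p true else y / p false
  else x.

(** The strict comparison selects 1 only if a positive value is left to expand; this excludes a last
    1 when [x > 0]. *)
Definition quasi_greedy (x : R) : sequence01 :=
  fun n => 1 - p true < greedy_orbit x n.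

(** Under digit 0 the orbit does not exceed 1 because [y] <= 1 - p1 <= 1/2 <= p0. *)
Lemma greedy_orbit_itv x n : 0 <= x <= 1 -> 0 <= greedy_orbit x n <= 1.
Proof.
move=> x01; elim: n => //= n; set y := greedy_orbit x n => /andP[y0 y1].
have P0 := p_half false; have P1 := p_half true.
case: ltP => h.
  have : (1 - y) / p true <= 1 by rewrite ler_pdivrMr; lra.
  have : 0 <= (1 - y) / p true by rewrite divr_ge0; lra.
  by lra.
have -> /= : 0 <= y / p false by rewrite divr_ge0; lra.
by rewrite ler_pdivrMr; lra.
Qed.

Lemma greedy_orbit_gt0 x n : 0 < x <= 1 -> 0 < greedy_orbit x n.
Proof.
move=> /andP[x0 x1]; elim: n => //= n; set y := greedy_orbit x n => y0.
have P0 := p_half false; have P1 := p_half true.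
case: (ltP _ y) => h; last by rewrite divr_gt0; lra.
by rewrite subr_gt0 ltr_pdivrMr; lra.
Qed.

Lemma v_quasi_greedy x n : 0 <= x <= 1 ->
  v (tail n (quasi_greedy x)) = greedy_orbit x n.
Proof.
move=> x01; apply: v_orbit => {}n; split; first exact: greedy_orbit_itv.
have P0 := p_half false; have P1 := p_half true.
rewrite /quasi_greedy /branch /=; case: ltP => _; field; lra.
Qed.

Lemma infinite_quasi_greedy x : 0 < x <= 1 -> infinite_seq (quasi_greedy x).
Proof.
move=> x01 [n [jn last]].
have : v (tail n.+1 (quasi_greedy x)) = 0.
  apply: v_cst0 => k; rewrite /tail.
  have := last (n.+1 + k)%N; rewrite ltnS leq_addr => /(_ isT).
  by case: quasi_greedy.
rewrite v_quasi_greedy; last by lra.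
by have := greedy_orbit_gt0 _ n.+1 x01; lra.
Qed.

(** If a larger infinite [j] first differs at [n], the tails there have equal values, at most 1 - p1
    by the choice of digit 0 and at least 1 - p1 by the digit 1 of [j]. The rest of [j] then has
    value 0, which makes this 1 its last. *)
Lemma max_infinite_quasi_greedy x : 0 < x <= 1 ->
  max_infinite v x (quasi_greedy x).
Proof.
move=> x01; have x01' : 0 <= x <= 1 by lra.
split; [exact: (v_quasi_greedy x 0 x01')|exact: infinite_quasi_greedy|].
move=> j vj infj; rewrite leNgt; apply/negP => /lexi_ltP[n [pre gn jn]].
have [K _] := v_prefix _ _ _ pre.
rewrite vj [v (quasi_greedy x)](v_quasi_greedy x 0)//= subrr mulr0 => /eqP.
rewrite subr_eq0 v_quasi_greedy// v_tail1// => /eqP e.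
apply: infj; exists n; split => // m nm; apply/eqP => jm.
have v0 : v (tail n.+1 j) = 0.
  move: gn; rewrite /quasi_greedy => /negbT; rewrite -leNgt e.
  by have := v_ge0 (tail n.+1 j); have := p_half true; nra.
by have := v_eq0 _ v0 (m - n.+1)%N; rewrite /tail subnKC// jm.
Qed.

Lemma admissibleP j : admissible p v j <-> (forall j', v j' = v j -> j' = j).
Proof.
split=> [adm j' e|uniq n].
  apply: contrapT => ne.
  case fd: (first_diff j j') => [n|]; last first.
    by move/first_diff_NoneP: fd => fd; rewrite fd in ne.
  move/first_diff_SomeP: fd => [pre nen].
  have [K _] := v_prefix n j j' pre.
  rewrite e subrr mulr0 => /eqP; rewrite subr_eq0 => /eqP en.
  (* A tail starting with 0 has value at most p0 and one starting with 1 at least 1 - p1, so the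
     common value lies in the switch region. *)
  have := adm n; rewrite en.
  have P0 := p_half false; have P1 := p_half true.
  have V0 := v_ge0 (tail n.+1 j'); have V1 := v_le1 (tail n.+1 j').
  case: (boolP (j n)) nen => jn; case: (boolP (j' n)) => // j'n _.
    by rewrite v_tail0 ?(negbTE j'n)//; nra.
  by rewrite v_tail1 ?j'n//; nra.
have P0 := p_half false; have P1 := p_half true.
have V0 := v_ge0 (tail n j); have V1 := v_le1 (tail n j).
(* From a value in the switch region the other digit is possible too; [z] is what then remains to be
   expanded. *)
have swap z : 0 <= z <= 1 -> v (tail n j) = branch p (~~ j n) z -> False.
  move=> z01 e; have := v_graft n j (~~ j n) (quasi_greedy z).
  have vz : v (quasi_greedy z) = z by exact: (v_quasi_greedy z 0 z01).
  rewrite vz => /(_ e) /uniq /(congr1 (fun g => g n)).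
  by rewrite graft_eq; case: (j n).
case: (boolP (j n)) => jn; rewrite ltNge; apply/negP => h.
- apply: (swap (v (tail n j) / p false)).
    by rewrite divr_ge0 ?ler_pdivrMr; lra.
  by rewrite jn /branch /=; field; lra.
- apply: (swap (1 - (1 - v (tail n j)) / p true)).
    have : (1 - v (tail n j)) / p true <= 1 by rewrite ler_pdivrMr; lra.
    have : 0 <= (1 - v (tail n j)) / p true by rewrite divr_ge0; lra.
    by lra.
  by rewrite (negbTE jn) /branch /=; field; lra.
Qed.

Lemma admissible_cst b : admissible p v (wrep [:: b]).
Proof.
move=> n; rewrite wrep1; case: b.
  by rewrite v_cst1 ?p_lt1// => k; exact: wrep1.
by rewrite v_cst0 ?subr_gt0 ?p_lt1// => k; exact: wrep1.
Qed.

(** * The sequence (10)^oo, the family 0^k (10)^oo and the comparison with alpha^0 *)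

Local Notation y10 := (v (wrep [:: true; false])).

Lemma v_wrep01 : v (wrep [:: false; true]) = p false * y10.
Proof. by have [_ ->] := hv (wrep [:: false; true]); rewrite tail1_wrep01. Qed.

Lemma v_wrep10 : y10 * (1 - p false * p true) = 1 - p true.
Proof.
have [_] := hv (wrep [:: true; false]).
rewrite tail1_wrep10 v_wrep01 /branch /= => e.
by rewrite mulrBr mulr1 {1}e; ring.
Qed.

Lemma y10_gt0 : 0 < y10.
Proof.
rewrite lt0r v_ge0 andbT; apply/eqP => y0.
by have := v_wrep10; have := p_lt1 true; rewrite y0; lra.
Qed.

Lemma admissible_const j : 1 <= p false * (1 + p true) -> admissible p v j ->
  exists b, j = wrep [:: b].
Proof.
move=> hp adm.
have P0 := p_half false; have P1 := p_half true.
have Q0 := p_lt1 false; have Q1 := p_lt1 true.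
have val0 n : j n = false -> p false * v (tail n.+1 j) < 1 - p true.
  by move=> jn; have := adm n; rewrite jn v_tail0.
(* A tail 011... has value at least p0 (1 - p1) (1 + p1) >= 1 - p1, hence not below the switch
   region. *)
have no011 n : j n = false -> j n.+1 = true -> j n.+2 = false.
  move=> jn jn1; apply/negbTE/negP => jn2.
  have := val0 n jn; rewrite (v_tail1 _ _ jn1) (v_tail1 _ _ jn2).
  have := v_ge0 (tail n.+3 j); set z := v _ => z0.
  have : 0 <= p false * (p true * (p true * z)) by rewrite !mulr_ge0; lra.
  have : 0 <= (p false * (1 + p true) - 1) * (1 - p true).
    by rewrite mulr_ge0; lra.
  by nra.
(* Admissibility at [n.+2] bounds that tail by 1 - p1, so admissibility at [n] gives p0 (1 - p1 +
   p1^2) < 1 - p1. This contradicts p0 >= 1/(1 + p1) because p1 >= 1/2. *)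
have no100 n : j n = true -> j n.+1 = false -> j n.+2 = true.
  move=> jn jn1; apply/negbNE/negP => /negbTE jn2.
  have := adm n; rewrite jn (v_tail1 _ _ jn) (v_tail0 _ _ jn1).
  have := adm n.+2; rewrite jn2; set z := v _ => z0 hn.
  have : p true * (p false * z) <= p true * (p false * (1 - p true)).
    by rewrite !ler_pM2l; lra.
  have : 0 <= (p false * (1 + p true) - 1) * (1 - p true + p true * p true).
    by apply: mulr_ge0; nra.
  by nra.
have no01 n : j n = false -> j n.+1 = true -> False.
  move=> jn jn1.
  have alt k : j (n.+1 + k)%N = ~~ odd k.
    (* Two consecutive digits determine the next one, so the induction carries both. *)
    suff : j (n + k)%N = odd k /\ j (n.+1 + k)%N = ~~ odd k by case.
    elim: k => [|k [IH1 IH2]]; first by rewrite !addn0.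
    rewrite !addnS -addSn IH2 /=; split => //; rewrite negbK addSn.
    move: IH1 IH2; rewrite addSn.
    by case: (odd k) => /=; [exact: no100|exact: no011].
  (* By [v_wrep10], 1 - p1 = [y10] (1 - p0 p1), so 0 (10)^oo lies below the switch region only if p0
     (1 + p1) < 1. *)
  have := val0 n jn.
  have -> : tail n.+1 j = wrep [:: true; false].
    by apply: funext => k; rewrite wrep10E; exact: alt.
  by have := v_wrep10; have := y10_gt0; nra.
exists (j 0%N); apply: funext => n; rewrite wrep1.
elim: n => // n <-.
case jn: (j n); case jn1: (j n.+1) => //.
(* A block 10 continues with 1, which creates a block 01. *)
- by have /no01 := jn1; move/(_ (no100 _ jn jn1)).
- by have := no01 _ jn jn1.
Qed.

Definition cons0 (j : sequence01) : sequence01 :=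
  fun n => if n is m.+1 then j m else false.

Lemma v_cons0 j : v (cons0 j) = p false * v j.
Proof. exact: (@v_tail0 0 (cons0 j)). Qed.

Lemma v_iter_cons0 k :
  v (iter k cons0 (wrep [:: true; false])) = p false ^+ k * y10.
Proof.
by elim: k => [|k IH]; rewrite ?expr0 ?mul1r//= v_cons0 IH exprS mulrA.
Qed.

(** The first inequality puts 0 (10)^oo below the switch region and the second puts (10)^oo above
    it; further leading zeros only decrease the value. *)
Lemma admissible_iter_cons0 k :
  p false * (1 + p true) < 1 -> p true * (1 + p false) < 1 ->
  admissible p v (iter k cons0 (wrep [:: true; false])).
Proof.
move=> h0 h1; have Y := y10_gt0; have E := v_wrep10.
have P0 := p_half false; have Q0 := p_lt1 false.
have py : p false * y10 < 1 - p true by nra.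
have adm10 : admissible p v (wrep [:: true; false]).
  move=> n; rewrite wrep10E; have [on|on] := boolP (odd n).
    have -> : tail n (wrep [:: true; false]) = wrep [:: false; true].
      by apply: funext => i; rewrite /tail wrep10E wrep01E oddD on /= negbK.
    by rewrite v_wrep01.
  rewrite tail_wrep10//.
  have : p false * (1 - p false * p true) < y10 * (1 - p false * p true) by nra.
  by rewrite ltr_pM2r//; have := p_half true; have := p_lt1 true; nra.
elim: k => [//|k IH [|n]]; last exact: (IH n).
suff : v (iter k.+1 cons0 (wrep [:: true; false])) < 1 - p true by [].
rewrite v_iter_cons0.
apply: le_lt_trans py; rewrite exprSr -mulrA ler_piMl// ?mulr_ge0//; try lra.
by rewrite exprn_ile1//; lra.
Qed.

Lemma iter_cons0_inj : injective (fun k => iter k cons0 (wrep [:: true; false])).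
Proof.
move=> k l /(congr1 v); rewrite !v_iter_cons0.
have Y := y10_gt0; have P0 := p_half false; have Q0 := p_lt1 false.
move/(mulIf (lt0r_neq0 Y)); apply: ieexprIn; first by lra.
by rewrite lt_eqF.
Qed.

(** Here [x] = (1 - p1)/p0 is the normalized argument of alpha^0. Since [y10] (1 - p0 p1) = 1 - p1 =
    p0 [x], the right-hand side amounts to [y10 < x]. *)
Lemma wrep10_lt_max_infinite x j : p false * x = 1 - p true ->
  max_infinite v x j ->
  (wrep [:: true; false] < j)%O <-> p false * (1 + p true) < 1.
Proof.
move=> hx [vj infj maxj].
have P0 := p_half false; have P1 := p_half true.
have Q0 := p_lt1 false; have Q1 := p_lt1 true.
have Y := y10_gt0; have E := v_wrep10.
split=> [/lexi_ltP[n [pre wn jn]]|hp]; last first.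
  have xy : y10 < x by rewrite -(ltr_pM2l (_ : 0 < p false)) ?hx; nra.
  rewrite ltNge; apply/negP; rewrite le_eqVlt => /orP[/eqP e|].
    by move: xy; rewrite -vj e; lra.
  (* The digit 1 of (10)^oo at [n] makes [n] even, so its tail is (10)^oo again, and [v_prefix]
     keeps the tail of [j] above [y10], hence above 1 - p1. *)
  move=> /lexi_ltP[n [pre jn wn]].
  have [K K1] := v_prefix _ _ _ pre.
  have := wn; rewrite wrep10E => /tail_wrep10 ->; rewrite vj => eK.
  have vn : y10 < v (tail n j) by nra.
  (* Changing the digit 0 of [j] at [n] to 1 leaves the positive value [z], whose quasi-greedy
     expansion yields a larger infinite expansion of [x]. *)
  set z := 1 - (1 - v (tail n j)) / p true.
  have z01 : 0 < z <= 1.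
    have V1 := v_le1 (tail n j).
    have y1 : 1 - p true < y10 by nra.
    have : (1 - v (tail n j)) / p true < 1 by rewrite ltr_pdivrMr; lra.
    have : 0 <= (1 - v (tail n j)) / p true by rewrite divr_ge0; lra.
    by rewrite /z; lra.
  have [vz infz _] := max_infinite_quasi_greedy _ z01.
  set g := graft n j true (quasi_greedy z).
  have vg : v g = x.
    rewrite v_graft// vz /branch /z; field; lra.
  have /lexi_ltP jg : exists n, [/\ forall m, (m < n)%N -> j m = g m,
      j n = false & g n = true].
    exists n; split=> //; last exact: graft_eq.
    by move=> m mn; rewrite /g graft_lt.
  have infg : infinite_seq g.
    apply: (@infinite_tail n.+1); first by rewrite tail_graft.
    rewrite tail_graft; apply: contrapT => /forallNP g0.
    have : v (quasi_greedy z) = 0.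
      by apply: v_cst0 => k; apply/negbTE/negP => /g0.
    by rewrite vz; lra.
  by have := maxj g vg infg; rewrite leNgt jg.
rewrite ltNge; apply/negP => hp.
have xy : x <= y10 by rewrite -(ler_pM2l (_ : 0 < p false)) ?hx; nra.
(* Step back to the even position [m] before the difference: there (10)^oo starts afresh while [j]
   continues with 11. *)
case: n pre wn jn => [|m] pre wn jn; first by move: wn; rewrite wrep10E.
have em : ~~ odd m by move: wn; rewrite wrep10E /= => /negbFE.
have jm : j m = true by rewrite -pre// wrep10E.
have [K K1] : exists2 K, 1 <= K & v (tail m (wrep [:: true; false]))
    - v (tail m j) = K * (y10 - v j).
  by apply: v_prefix => k km; apply: pre; exact: ltnW.
rewrite tail_wrep10// vj (v_tail1 _ _ jm) (v_tail1 _ _ jn) => eK.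
have V : 0 < v (tail m.+2 j).
  rewrite lt_neqAle v_ge0 andbT; apply/eqP => /esym v0.
  apply: infj; exists m.+1; split => // k mk.
  by have := v_eq0 _ v0 (k - m.+2)%N; rewrite /tail subnKC// => ->.
set w := v (tail m.+2 j) in eK V.
have KX : 0 <= (K - 1) * (y10 - x) by rewrite mulr_ge0; lra.
(* The gap [y10 - x] does not shrink when the prefix is removed, so the tail 11... of [j] has value
   at most [x]. As [w > 0], this yields p0 (1 - p1^2) < p0 [x] = 1 - p1, that is p0 (1 + p1) < 1. *)
have wx : 1 - p true * (1 - (1 - p true * (1 - w))) <= x by nra.
have : p false * (1 - p true * (1 - (1 - p true * (1 - w)))) <= 1 - p true.
  by rewrite -hx ler_pM2l; lra.
have : 0 < p false * (p true * (p true * w)) by rewrite !mulr_gt0; lra.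
have : 0 <= (p false * (1 + p true) - 1) * (1 - p true) by rewrite mulr_ge0; lra.
by nra.
Qed.

End Valuation.

(** * The value of an alphabet-base system *)

Section Pival.
Variables (R : realType) (S : alphabet_base R).
Local Notation q := (base S).
Local Notation d := (digit S).
Local Notation fixpt b := (d b / (q b - 1)).

Let q_gt1 b : 1 < q b. Proof. exact: base_gt1. Qed.
Let q_gt0 b : 0 < q b. Proof. exact: lt_trans ltr01 _. Qed.

Definition base_prod (j : sequence01) (n : nat) : R := \prod_(k < n) q (j k).

Definition partial_pival (j : sequence01) : R ^nat :=
  series (fun i => d (j i) / base_prod j i.+1).

Lemma base_prodS j n : base_prod j n.+1 = q (j 0%N) * base_prod (tail 1 j) n.
Proof. by rewrite /base_prod big_ord_recl. Qed.

Lemma base_prod_gt0 j n : 0 < base_prod j n.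
Proof. by apply: prodr_gt0 => k _; exact: q_gt0. Qed.

Lemma cvg_base_prodV j : (fun n => (base_prod j n)^-1) @ \oo --> (0 : R).
Proof.
pose c := Num.max (q false)^-1 (q true)^-1.
have qc b : (q b)^-1 <= c by rewrite le_max; case: b; rewrite lexx ?orbT.
have c0 : 0 <= c.
  by apply: le_trans (qc true); rewrite invr_ge0 ltW.
have c1 : c < 1 by rewrite gt_max !invf_lt1 ?q_gt1 ?q_gt0.
apply: (@squeeze_cvgr _ _ _ _ (fun=> 0) (GRing.exp c)).
- apply: nearW => n; rewrite invr_ge0 ltW ?base_prod_gt0//=.
  elim: n j => [|n IH] j; first by rewrite /base_prod big_ord0 invr1.
  by rewrite base_prodS invfM exprS ler_pM// invr_ge0 ltW// base_prod_gt0.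
- exact: cvg_cst.
- by apply: cvg_expr; rewrite ger0_norm.
Qed.

Lemma partial_pivalS j n :
  partial_pival j n.+1 = (d (j 0%N) + partial_pival (tail 1 j) n) / q (j 0%N).
Proof.
rewrite /partial_pival !seriesEord /= big_ord_recl mulrDl; congr (_ + _).
  by rewrite base_prodS /base_prod big_ord0 mulr1.
rewrite mulr_suml; apply: eq_bigr => i _.
by rewrite lift0 base_prodS invfM mulrA mulrAC.
Qed.

Let L := Num.min (fixpt false) (fixpt true).
Let U := Num.max (fixpt false) (fixpt true).

(** Equivalently, the map sending x to ([d b] + x) / [q b] does not move [L] down or [U] up. *)
Lemma digit_bounds b : (q b - 1) * L <= d b <= (q b - 1) * U.
Proof.
have qb : 0 < q b - 1 by rewrite subr_gt0.
rewrite !(mulrC (q b - 1)) -(ler_pdivlMr _ _ qb) -(ler_pdivrMr _ _ qb).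
by rewrite /L /U ge_min le_max; case: b {qb}; rewrite !lexx ?orbT.
Qed.

(* Starting the partial sums at the lower bound [L] instead of [0] makes them
   monotone, whatever the signs of the digits. *)
Lemma shifted_partial_bounds j n :
  let w i := partial_pival j i + L / base_prod j i in
  L <= w n /\ w n <= w n.+1 /\ w n.+1 <= U.
Proof.
move=> /=; elim: n j => [|n IH] j.
  have E0 i : partial_pival i 0 = 0.
    by rewrite /partial_pival seriesEord /= big_ord0.
  rewrite partial_pivalS base_prodS !E0.
  rewrite /base_prod !big_ord0 invr1 !mulr1 add0r addr0 -mulrDl.
  have := digit_bounds (j 0%N); have Q := q_gt1 (j 0%N) => /andP[dL dU].
  have LU : L <= U by rewrite /L /U ge_min le_max lexx.
  by split => //; rewrite ler_pdivlMr ?ler_pdivrMr; nra.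
have step m : partial_pival j m.+1 + L / base_prod j m.+1 =
    (d (j 0%N) + (partial_pival (tail 1 j) m + L / base_prod (tail 1 j) m))
      / q (j 0%N).
  rewrite partial_pivalS base_prodS; field.
  by rewrite !gt_eqF ?base_prod_gt0.
have Q := q_gt1 (j 0%N).
rewrite !step; have [] := IH (tail 1 j).
set w0 := _ + _ / base_prod _ n; set w1 := _ + _ / base_prod _ n.+1.
have := digit_bounds (j 0%N) => /andP[dL dU] h0 [h1 h2].
by rewrite ler_pM2r ?invr_gt0 ?lerD2l ?ler_pdivlMr ?ler_pdivrMr; try nra.
Qed.

(** The shifted sums increase, stay within [[L], [U]], and the shift tends to 0. *)
Lemma cvg_partial_pival j :
  partial_pival j @ \oo --> pival S j /\ L <= pival S j <= U.
Proof.
pose w i := partial_pival j i + L / base_prod j i.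
have B n := shifted_partial_bounds j n.
have wc : cvgn w.
  apply: nondecreasing_is_cvgn.
    by apply/nondecreasing_seqP => n; have [_ []] := B n.
  by exists U => _ [n _ <-]; have [_ []] := B n; exact: le_trans.
have lc : (fun n => L * (base_prod j n)^-1) @ \oo --> L * 0.
  by apply: cvgMl_tmp; exact: cvg_base_prodV.
have pc : partial_pival j @ \oo --> limn w - L * 0.
  have -> : partial_pival j = w - (fun n => L * (base_prod j n)^-1).
    by apply: funext => n; rewrite /w !fctE addrK.
  exact: cvgB.
rewrite mulr0 subr0 in pc.
have e : pival S j = limn w by rewrite /pival; exact: cvg_lim pc.
rewrite e; split => //; apply/andP; split.
  by apply: limr_ge => //; apply: nearW => n; have [] := B n.
by apply: limr_le => //; apply: nearW => n; have [_ []] := B n; exact: le_trans.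
Qed.

Lemma pivalS j : pival S j = (d (j 0%N) + pival S (tail 1 j)) / q (j 0%N).
Proof.
have [c _] := cvg_partial_pival j; have [c1 _] := cvg_partial_pival (tail 1 j).
move: c; rewrite -cvg_shiftS.
rewrite (_ : [sequence _]_n = fun n =>
  (d (j 0%N) + partial_pival (tail 1 j) n) / q (j 0%N)); last first.
  by apply: funext => n; exact: partial_pivalS.
move=> c; apply: (cvg_unique _ c) => //.
by apply: cvgMr_tmp; apply: cvgD => //; exact: cvg_cst.
Qed.

Lemma pival_wrep1 b : pival S (wrep [:: b]) = fixpt b.
Proof.
have := pivalS (wrep [:: b]); rewrite wrep1.
have -> : tail 1 (wrep [:: b]) = wrep [:: b].
  by apply: funext => n; rewrite /tail !wrep1.
have Q := q_gt1 b; set x := pival _ _ => e.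
apply/eqP; rewrite eq_sym; apply/eqP.
have : x * q b = d b + x by rewrite {1}e divfK// gt_eqF.
move=> e2; have -> : d b = x * (q b - 1) by lra.
by rewrite mulfK// gt_eqF// subr_gt0.
Qed.

Lemma pival_itv j : lambda_ S <= pival S j <= Lambda_ S.
Proof.
by have [_] := cvg_partial_pival j; rewrite /lambda_ /Lambda_ !pival_wrep1.
Qed.

Lemma regularE : regular S ->
  [/\ d false = (q false - 1) * lambda_ S, d true = (q true - 1) * Lambda_ S &
      lambda_ S < Lambda_ S].
Proof.
have Q0 := q_gt1 false; have Q1 := q_gt1 true.
have E b : d b = (q b - 1) * fixpt b.
  by rewrite mulrC divfK// gt_eqF// subr_gt0.
rewrite /regular /lambda_ /Lambda_ !pival_wrep1.
have := E false; have := E true.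
set a := fixpt false; set b := fixpt true => -> -> [].
case: (ltP a b) => ab; first by split.
(* If [b <= a], then [lambda_] is [b], the fixed point of digit 1, and the first regularity
   inequality becomes (q0 - 1)(a - b) < 0. *)
rewrite ltr_pdivrMr// => h.
exfalso; move: h; rewrite -subr_gt0.
have -> : ((q true - 1) * b + b) / q true = b.
  by field; rewrite gt_eqF.
by move=> ?; nra.
Qed.

Hypothesis hreg : regular S.

(** * Normalization to the unit interval *)

Definition inv_base (b : bool) : R := (q b)^-1.

Definition normalize (x : R) : R := (x - lambda_ S) / (Lambda_ S - lambda_ S).

Definition unit_pival (j : sequence01) : R := normalize (pival S j).

Lemma normalize_inj : injective normalize.
Proof.
have [_ _ lt] := regularE hreg => x y /mulIf.
by rewrite invr_eq0 subr_eq0 gt_eqF// => /(_ isT) /addIr.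
Qed.

Lemma valuation_unit_pival : valuation inv_base unit_pival.
Proof.
have [e0 e1 lt] := regularE hreg => j.
have D : 0 < Lambda_ S - lambda_ S by rewrite subr_gt0.
split.
  have /andP[l u] := pival_itv j.
  rewrite /unit_pival /normalize; apply/andP; split.
    by rewrite divr_ge0 ?subr_ge0// ltW.
  by rewrite ler_pdivrMr// mul1r lerB.
rewrite /unit_pival /normalize pivalS /branch /inv_base.
case: (j 0%N); [rewrite e1|rewrite e0]; field;
  by rewrite ?subr_eq0 !gt_eqF.
Qed.

Lemma max_infinite_expansionP x j :
  is_max_infinite_expansion S x j <->
  max_infinite unit_pival (normalize x) j.
Proof.
split=> -[ex infj maxj]; split => //.
- by rewrite /unit_pival ex.
- by move=> j' /normalize_inj; exact: maxj.
- exact: normalize_inj ex.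
- by move=> j' ex'; apply: maxj; rewrite /unit_pival ex'.
Qed.

(** Exchanging the digits reverses the order and swaps infinite with co-infinite, so a smallest
    co-infinite expansion becomes a largest infinite one. *)
Lemma min_coinfinite_expansionP x j :
  is_min_coinfinite_expansion S x j <->
  max_infinite (fun i => 1 - unit_pival (flip i)) (1 - normalize x) (flip j).
Proof.
split=> -[ex infj minj]; split.
- by rewrite flipK /unit_pival ex.
- exact/infinite_flip.
- move=> j' /addrI /oppr_inj /normalize_inj ex' infj'.
  rewrite -(flipK j') lexi_le_flip; apply: minj => //.
  by apply/infinite_flip; rewrite flipK.
- by move: ex; rewrite flipK => /addrI /oppr_inj /normalize_inj.
- exact/infinite_flip.
- move=> j' ex' infj'; rewrite -lexi_le_flip; apply: minj.
    by rewrite flipK /unit_pival ex'.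
  exact/infinite_flip.
Qed.

(** * Transfer of the abstract results to the system *)

Hypothesis base_le2 : forall b, q b <= 2.

Lemma inv_base_half b : 2^-1 <= inv_base b.
Proof. by rewrite /inv_base lef_pV2 ?posrE. Qed.

Lemma inv_base_lt1 b : inv_base b < 1.
Proof. by rewrite /inv_base invf_lt1. Qed.

Let flip_val := valuation_flip _ _ _ valuation_unit_pival.
Let half_flip b := inv_base_half (~~ b).
Let lt1_flip b := inv_base_lt1 (~~ b).

Lemma univoque_seqE :
  univoque_seq S = [set j | admissible inv_base unit_pival j].
Proof.
have adm := admissibleP _ _ _ inv_base_half inv_base_lt1 valuation_unit_pival.
apply/seteqP; split => j /=.
  move=> [x [_ [i [_ uniq]]] ex]; apply/adm => j' /normalize_inj e.
  by rewrite -(uniq j) // -(uniq j') // /is_expansion e.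
move=> /adm uniq; exists (pival S j); last by [].
split; first exact: pival_itv.
exists j; split => // j' e; apply/esym/uniq; rewrite /unit_pival.
by congr normalize.
Qed.

Lemma base_gt_inv_base b c :
  1 + (q c)^-1 < q b <-> inv_base b * (1 + inv_base c) < 1.
Proof. by rewrite /inv_base mulrC ltr_pdivrMr// mul1r. Qed.

Lemma wrep10_lt_alpha0 :
  (wrep [:: true; false] < alpha0 S)%O <-> 1 + (q true)^-1 < q false.
Proof.
have [e0 e1 lt] := regularE hreg.
have P0 := inv_base_half false; have P1 := inv_base_lt1 true.
have Q1 := inv_base_half true.
set x := q false * ((d true + lambda_ S) / q true - d false / q false).
have hx : inv_base false * normalize x = 1 - inv_base true.
  rewrite /normalize /x /inv_base e0 e1; field.
  by rewrite subr_eq0 !gt_eqF.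
have x01 : 0 < normalize x <= 1.
  apply/andP; split.
    by rewrite -(pmulr_rgt0 _ (_ : 0 < inv_base false)) ?hx ?subr_gt0//; lra.
  by rewrite -(ler_pM2l (_ : 0 < inv_base false)) ?hx; lra.
have ex := max_infinite_quasi_greedy _ _ _ inv_base_half inv_base_lt1
  valuation_unit_pival _ x01.
rewrite base_gt_inv_base.
apply: (wrep10_lt_max_infinite _ _ _ inv_base_half inv_base_lt1
  valuation_unit_pival _ _ hx).
apply/max_infinite_expansionP; rewrite /alpha0 /a_exp -/x.
(* The quasi-greedy expansion witnesses existence, so [xget] does not return its default. *)
apply: (@xgetI _ _ _ (quasi_greedy _ inv_base (normalize x))).
exact/max_infinite_expansionP.
Qed.

(** This is the comparison for alpha^0 after exchange of the digits, which turns (01)^oo into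
    (10)^oo. *)
Lemma gamma1_lt_wrep01 :
  (gamma1 S < wrep [:: false; true])%O <-> 1 + (q false)^-1 < q true.
Proof.
have [e0 e1 lt] := regularE hreg.
have P0 := inv_base_half false; have P1 := inv_base_lt1 false.
have Q1 := inv_base_half true.
set x := q true * ((d false + Lambda_ S) / q false - d true / q true).
have hx : inv_base true * (1 - normalize x) = 1 - inv_base false.
  rewrite /normalize /x /inv_base e0 e1; field.
  by rewrite subr_eq0 !gt_eqF.
have x01 : 0 < 1 - normalize x <= 1.
  apply/andP; split.
    by rewrite -(pmulr_rgt0 _ (_ : 0 < inv_base true)) ?hx ?subr_gt0//; lra.
  by rewrite -(ler_pM2l (_ : 0 < inv_base true)) ?hx; lra.
have ex := max_infinite_quasi_greedy _ _ _ half_flip lt1_flip flip_val _ x01.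
rewrite base_gt_inv_base -lexi_lt_flip -flip_wrep10 flipK.
apply: (wrep10_lt_max_infinite _ _ _ half_flip lt1_flip flip_val _ _ hx).
apply/min_coinfinite_expansionP; rewrite /gamma1 /m_exp -/x.
pose g := quasi_greedy _ (fun b => inv_base (~~ b)) (1 - normalize x).
apply: (@xgetI _ _ _ (flip g)).
by apply/min_coinfinite_expansionP; rewrite flipK.
Qed.

Lemma infinite_univoque_seq :
  1 + (q true)^-1 < q false -> 1 + (q false)^-1 < q true ->
  infinite_set (univoque_seq S).
Proof.
move=> /base_gt_inv_base h0 /base_gt_inv_base h1; rewrite univoque_seqE.
apply/infiniteP/pcard_leP/injfunPex.
exists (fun k => iter k cons0 (wrep [:: true; false])).
  move=> k _; exact: (admissible_iter_cons0 _ _ _ inv_base_half inv_base_lt1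
    valuation_unit_pival).
move=> k l _ _; exact: (iter_cons0_inj _ _ _ inv_base_half inv_base_lt1
    valuation_unit_pival).
Qed.

Lemma univoque_seq_cst :
  ~ (1 + (q true)^-1 < q false /\ 1 + (q false)^-1 < q true) ->
  univoque_seq S = [set wrep [:: false]; wrep [:: true]].
Proof.
rewrite !base_gt_inv_base univoque_seqE => h.
apply/seteqP; split => j; last first.
  by case=> ->; exact: (admissible_cst _ _ _ inv_base_half inv_base_lt1
    valuation_unit_pival).
suff cst : admissible inv_base unit_pival j -> exists b, j = wrep [:: b].
  by move=> /cst[[] ->]; [right|left].
have [h0|h0] := leP 1 (inv_base false * (1 + inv_base true)).
  exact: (admissible_const _ _ _ inv_base_half inv_base_lt1
    valuation_unit_pival).
have [h1|h1] := leP 1 (inv_base true * (1 + inv_base false)).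
  (* When the other inequality fails, the flipped sequence satisfies the hypotheses of
     [admissible_const]. *)
  move=> /admissible_flip.
  move=> /(admissible_const _ _ _ half_flip lt1_flip flip_val _ h1)[b e].
  exists (~~ b); apply: (inv_inj flipK); rewrite e.
  by apply: funext => n; rewrite /flip !wrep1 negbK.
by exfalso; exact: h.
Qed.

End Pival.

Theorem theorem1p6 (R : realType) (S : alphabet_base R)
    (hq0 : base S false <= 2) (hq1 : base S true <= 2) (hreg : regular S) :
  let i := infinite_set (univoque_seq S) in
  let ii := (wrep [:: true; false] < alpha0 S)%O
            /\ (gamma1 S < wrep [:: false; true])%O in
  let iii := 1 + (base S true)^-1 < base S false
             /\ 1 + (base S false)^-1 < base S true in
  (i <-> ii) /\ (ii <-> iii) /\
  (~ i -> univoque_seq S = [set wrep [:: false]; wrep [:: true]]).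
Proof.
move=> i ii iii.
have q2 b : base S b <= 2 by case: b.
have ii_iii : ii <-> iii.
  by rewrite /ii wrep10_lt_alpha0// gamma1_lt_wrep01.
have iii_i : iii -> i by case; exact: infinite_univoque_seq.
have i_iii : i -> iii.
  move=> hi; apply: contrapT => /(univoque_seq_cst _ _ hreg q2) e.
  by apply: hi; rewrite e; exact: finite_set2.
split; first by rewrite ii_iii.
split=> // ni; apply: univoque_seq_cst => // /iii_i.
exact: ni.
Qed.
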